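(* Assume the Framework and the Purification Postulate. Let $\rho\in\mathfrak S(\mathrm A)$ and let $\{\mathcal A_i\}_{i\in X}$ be a test from $\mathrm A$ to $\mathrm A$. Then $\sum_{i\in X}\mathcal A_i\,\sigma=\sigma$ for all $\sigma\in D_\rho$ (the test is non-disturbing upon input of $\rho$) if and only if there are probabilities $p_i\ge 0$ such that $\mathcal A_i\,\sigma=p_i\,\sigma$ for all $\sigma\in D_\rho$ and all $i\in X$. In particular, if $\rho$ is internal, a test satisfies $\sum_i\mathcal A_i\sigma=\sigma$ for all states $\sigma$ of $\mathrm A$ iff $\mathcal A_i\sigma=p_i\sigma$ for all states $\sigma$ of $\mathrm A$ and all $i$.
   Context: Framework. We work in an operational-probabilistic theory: there is a collection of systems $\mathrm A,\mathrm B,\dots$, closed under a composition $\mathrm A\mathrm B$ (associative, symmetric up to a reversible swap, with a trivial system $\mathrm I$ satisfying $\mathrm A\mathrm I=\mathrm A$); for each pair of systems a set $\mathfrak T(\mathrm A,\mathrm B)$ of transformations; a test from $\mathrm A$ to $\mathrm B$ is a finite collection $\{\mathcal C_i\}_{i\in X}\subseteq\mathfrak T(\mathrm A,\mathrm B)$, and every transformation belongs to some test. Tests are closed under sequential composition, parallel composition ($\otimes$), coarse-graining (summing outcomes over the blocks of a partition of $X$) and conditioning (choosing the next test depending on the outcome of the previous one). States of $\mathrm A$ are the elements of $\mathfrak S(\mathrm A):=\mathfrak T(\mathrm I,\mathrm A)$, effects are the elements of $\mathfrak T(\mathrm A,\mathrm I)$, and transformations $\mathrm I\to\mathrm I$ are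 probabilities in $[0,1]$ (those of a test sum to $1$; composition is multiplication). An effect $a$ and a state $\rho$ give the probability $(a|\rho)$. States (effects) are identified when they give equal probabilities on all effects (states); transformations $\mathcal C,\mathcal C'$ are identified when $\mathcal C\otimes\mathcal I_{\mathrm S}$ and $\mathcal C'\otimes\mathcal I_{\mathrm S}$ act identically on all states of $\mathrm A\mathrm S$ for every system $\mathrm S$. States span a finite-dimensional real vector space $\mathfrak S_{\mathbb R}(\mathrm A)$, transformations act linearly, and $\mathfrak T_{\mathbb R}(\mathrm A,\mathrm B)$ is the real span of $\mathfrak T(\mathrm A,\mathrm B)$. Standing assumptions: (i) causality: each system $\mathrm A$ has a unique deterministic effect $e_{\mathrm A}$ (the effect forming a one-outcome observation test), and $e_{\mathrm A\mathrm B}=e_{\mathrm A}\otimes e_{\mathrm B}$; (ii) local discriminability: if two states of $\mathrm A\mathrm B$ differ, some product effect $a\otimes b$ gives them different probabilities; (iii) all sets of states are closed, the theory is not deterministic (hence all sets of states, effects and transformations are convex), and perfectly distinguishable states exist. A state $\rho$ is normalized if $(e|\rho)=1$; $\mathfrak S_1(\mathrm A)$ is the set of normalized states. A channel is a $\mathcal C\in\mathfrak T(\mathrm A,\mathrm B)$ with $e_{\mathrm B}\circ\mathcal C=e_{\mathrm A}$. A channel $\mathcal U\in\mathfrak T(\mathrm A,\mathrm B)$ is reversible if some channel $\mathcal W\in\mathfrak T(\mathrm B,\mathrm A)$ satisfies $\mathcal W\mathcal U=\mathcal I_{\mathrm A}$, $\mathcal U\mathcal W=\mathcal I_{\mathrm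 B}$; $\mathbf G_{\mathrm A}$ is the group of reversible channels on $\mathrm A$. The marginal of a state $\sigma$ of $\mathrm A\mathrm B$ on $\mathrm A$ is $(\mathcal I_{\mathrm A}\otimes e_{\mathrm B})\sigma$. Refinement. For $\mathcal C\in\mathfrak T(\mathrm A,\mathrm B)$, write $\mathcal D\prec\mathcal C$ if there are a test $\{\mathcal D_j\}_{j\in Y}$ and $Y_0\subseteq Y$ with $\mathcal C=\sum_{j\in Y_0}\mathcal D_j$ and $\mathcal D\in\{\mathcal D_j\}_{j\in Y_0}$; the refinement set is $D_{\mathcal C}=\{\mathcal D:\mathcal D\prec\mathcal C\}$. $\mathcal C$ is atomic if $\mathcal D\prec\mathcal C$ implies $\mathcal D=\lambda\mathcal C$ for some $\lambda\in[0,1]$. A pure state is an atomic state; a state is mixed otherwise. A state $\omega$ of $\mathrm A$ is internal if $\mathrm{Span}(D_\omega)=\mathfrak S_{\mathbb R}(\mathrm A)$. Purification Postulate. For every $\rho\in\mathfrak S_1(\mathrm A)$ there are a system $\mathrm B$ and a pure $\Psi\in\mathfrak S_1(\mathrm A\mathrm B)$ with $(\mathcal I_{\mathrm A}\otimes e_{\mathrm B})\Psi=\rho$ (a purification of $\rho$, with purifying system $\mathrm B$); and if $\Psi,\Psi'\in\mathfrak S_1(\mathrm A\mathrm B)$ are purifications of the same state, then $\Psi'=(\mathcal I_{\mathrm A}\otimes\mathcal U)\Psi$ for some $\mathcal U\in\mathbf G_{\mathrm B}$. *)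

(* Defs.v *)
From Stdlib Require Import Reals List.
Import ListNotations.
Local Open Scope R_scope.

Record OPTdata : Type := mkOPT {
  sys : Type;
  sI : sys;
  cmp : sys -> sys -> sys;
  Tr : sys -> sys -> Type;                      (* T_R(A,B): real span of transformations *)
  tzero : forall A B, Tr A B;
  tadd : forall A B, Tr A B -> Tr A B -> Tr A B;
  tscal : forall A B, R -> Tr A B -> Tr A B;
  seqc : forall A B C, Tr B C -> Tr A B -> Tr A C;
  par : forall A B C D, Tr A B -> Tr C D -> Tr (cmp A C) (cmp B D);
  idt : forall A, Tr A A;
  runit : forall A, Tr (cmp A sI) A;
  lunit : forall A, Tr (cmp sI A) A;
  assoc : forall A B C, Tr (cmp (cmp A B) C) (cmp A (cmp B C));
  swap : forall A B, Tr (cmp A B) (cmp B A);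
  tval : Tr sI sI -> R;
  eff : forall A, Tr A sI;                      (* the deterministic effect e_A *)
  test : forall A B, list (Tr A B) -> Prop      (* finite tests {C_i}_{i in X}, X = {0..n-1} *)
}.

Arguments sI {_}.
Arguments cmp {_} _ _.
Arguments tzero {_ A B}.
Arguments tadd {_ A B} _ _.
Arguments tscal {_ A B} _ _.
Arguments seqc {_ A B C} _ _.
Arguments par {_ A B C D} _ _.
Arguments idt {_} A.
Arguments runit {_} A.
Arguments lunit {_} A.
Arguments assoc {_} A B C.
Arguments swap {_} A B.
Arguments tval {_} _.
Arguments eff {_} A.
Arguments test {_ A B} _.

(* membership in T(A,B): every transformation belongs to some test *)
Definition phys {T : OPTdata} {A B : sys T} (C : Tr T A B) : Prop :=
  exists l, test l /\ In C l.

Definition tsum {T : OPTdata} {A B : sys T} (l : list (Tr T A B)) : Tr T A B :=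
  fold_right tadd tzero l.

Definition tnth {T : OPTdata} {A B : sys T} (l : list (Tr T A B)) (i : nat) : Tr T A B :=
  nth i l tzero.

Definition lincomb {T : OPTdata} {A B : sys T} (cs : list (R * Tr T A B)) : Tr T A B :=
  fold_right (fun c acc => tadd (tscal (fst c) (snd c)) acc) tzero cs.

Definition tsum_sel {T : OPTdata} {A B : sys T} (l : list (Tr T A B)) (Y0 : nat -> bool)
  : Tr T A B :=
  tsum (map (tnth l) (filter Y0 (seq 0 (length l)))).

Definition sumR (l : list R) : R := fold_right Rplus 0 l.

Definition prob {T : OPTdata} {A : sys T} (a : Tr T A sI) (rho : Tr T sI A) : R :=
  tval (seqc a rho).

Definition seq_test {T : OPTdata} {A B C : sys T}
  (l1 : list (Tr T A B)) (l2 : list (Tr T B C)) : list (Tr T A C) :=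
  flat_map (fun c => map (fun b => seqc c b) l1) l2.

Definition par_test {T : OPTdata} {A B C D : sys T}
  (l1 : list (Tr T A B)) (l2 : list (Tr T C D)) : list (Tr T (cmp A C) (cmp B D)) :=
  flat_map (fun a => map (fun b => par a b) l2) l1.

Definition cgrain {T : OPTdata} {A B : sys T} (l : list (Tr T A B)) (f : nat -> nat) (m : nat)
  : list (Tr T A B) :=
  map (fun j => tsum_sel l (fun i => Nat.eqb (f i) j)) (seq 0 m).

Definition cond_test {T : OPTdata} {A B C : sys T}
  (l1 : list (Tr T A B)) (L : nat -> list (Tr T B C)) : list (Tr T A C) :=
  flat_map (fun i => map (fun c => seqc c (tnth l1 i)) (L i)) (seq 0 (length l1)).

Definition normalized {T : OPTdata} {A : sys T} (rho : Tr T sI A) : Prop :=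
  phys rho /\ prob (eff A) rho = 1.

Definition channel {T : OPTdata} {A B : sys T} (C : Tr T A B) : Prop :=
  phys C /\ seqc (eff B) C = eff A.

Definition reversible {T : OPTdata} {A B : sys T} (U : Tr T A B) : Prop :=
  channel U /\ exists W : Tr T B A, channel W /\ seqc W U = idt A /\ seqc U W = idt B.

Definition marginal {T : OPTdata} {A B : sys T} (Psi : Tr T sI (cmp A B)) : Tr T sI A :=
  seqc (runit A) (seqc (par (idt A) (eff B)) Psi).

Definition refines {T : OPTdata} {A B : sys T} (D C : Tr T A B) : Prop :=
  exists (l : list (Tr T A B)) (Y0 : nat -> bool),
    test l /\ C = tsum_sel l Y0 /\
    exists j, (j < length l)%nat /\ Y0 j = true /\ D = tnth l j.

Definition atomic {T : OPTdata} {A B : sys T} (C : Tr T A B) : Prop :=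
  forall D, refines D C -> exists lam, 0 <= lam <= 1 /\ D = tscal lam C.

Definition pure {T : OPTdata} {A : sys T} (rho : Tr T sI A) : Prop :=
  phys rho /\ atomic rho.

Definition internal {T : OPTdata} {A : sys T} (omega : Tr T sI A) : Prop :=
  phys omega /\
  forall x : Tr T sI A, exists cs : list (R * Tr T sI A),
    Forall (fun c => refines (snd c) omega) cs /\ x = lincomb cs.

Record OPTAxioms (T : OPTdata) : Prop := {
  ax_add_assoc : forall A B (x y z : Tr T A B), tadd x (tadd y z) = tadd (tadd x y) z;
  ax_add_comm : forall A B (x y : Tr T A B), tadd x y = tadd y x;
  ax_add_zero : forall A B (x : Tr T A B), tadd x tzero = x;
  ax_add_opp : forall A B (x : Tr T A B), tadd x (tscal (-1) x) = tzero;
  ax_scal_one : forall A B (x : Tr T A B), tscal 1 x = x;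
  ax_scal_mul : forall A B r s (x : Tr T A B), tscal r (tscal s x) = tscal (r * s) x;
  ax_scal_addr : forall A B r s (x : Tr T A B), tscal (r + s) x = tadd (tscal r x) (tscal s x);
  ax_scal_addv : forall A B r (x y : Tr T A B), tscal r (tadd x y) = tadd (tscal r x) (tscal r y);
  ax_span : forall A B (x : Tr T A B), exists cs : list (R * Tr T A B),
      Forall (fun c => phys (snd c)) cs /\ x = lincomb cs;
  ax_findim : forall A : sys T, exists basis : list (Tr T sI A), forall x : Tr T sI A,
      exists cs : list (R * Tr T sI A), Forall (fun c => In (snd c) basis) cs /\ x = lincomb cs;
  ax_seq_assoc : forall A B C D (f : Tr T A B) (g : Tr T B C) (h : Tr T C D),
      seqc h (seqc g f) = seqc (seqc h g) f;
  ax_seq_idl : forall A B (f : Tr T A B), seqc (idt B) f = f;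
  ax_seq_idr : forall A B (f : Tr T A B), seqc f (idt A) = f;
  ax_seq_addl : forall A B C (g g' : Tr T B C) (f : Tr T A B),
      seqc (tadd g g') f = tadd (seqc g f) (seqc g' f);
  ax_seq_addr : forall A B C (g : Tr T B C) (f f' : Tr T A B),
      seqc g (tadd f f') = tadd (seqc g f) (seqc g f');
  ax_seq_scall : forall A B C r (g : Tr T B C) (f : Tr T A B),
      seqc (tscal r g) f = tscal r (seqc g f);
  ax_seq_scalr : forall A B C r (g : Tr T B C) (f : Tr T A B),
      seqc g (tscal r f) = tscal r (seqc g f);
  ax_par_seq : forall A B C A' B' C' (f : Tr T A B) (g : Tr T B C) (f' : Tr T A' B') (g' : Tr T B' C'),
      par (seqc g f) (seqc g' f') = seqc (par g g') (par f f');
  ax_par_id : forall A B : sys T, par (idt A) (idt B) = idt (cmp A B);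
  ax_par_addl : forall A B C D (f f' : Tr T A B) (g : Tr T C D),
      par (tadd f f') g = tadd (par f g) (par f' g);
  ax_par_addr : forall A B C D (f : Tr T A B) (g g' : Tr T C D),
      par f (tadd g g') = tadd (par f g) (par f g');
  ax_par_scall : forall A B C D r (f : Tr T A B) (g : Tr T C D),
      par (tscal r f) g = tscal r (par f g);
  ax_par_scalr : forall A B C D r (f : Tr T A B) (g : Tr T C D),
      par f (tscal r g) = tscal r (par f g);
  ax_runit_nat : forall A B (f : Tr T A B),
      seqc (runit B) (par f (idt (@sI T))) = seqc f (runit A);
  ax_lunit_nat : forall A B (f : Tr T A B),
      seqc (lunit B) (par (idt (@sI T)) f) = seqc f (lunit A);
  ax_assoc_nat : forall A B C D E F (f : Tr T A B) (g : Tr T C D) (h : Tr T E F),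
      seqc (assoc B D F) (par (par f g) h) = seqc (par f (par g h)) (assoc A C E);
  ax_swap_nat : forall A B C D (f : Tr T A B) (g : Tr T C D),
      seqc (swap B D) (par f g) = seqc (par g f) (swap A C);
  ax_swap_invol : forall A B : sys T, seqc (swap B A) (swap A B) = idt (cmp A B);
  ax_runit_rev : forall A : sys T, reversible (runit A);
  ax_lunit_rev : forall A : sys T, reversible (lunit A);
  ax_assoc_rev : forall A B C : sys T, reversible (assoc A B C);
  ax_swap_rev : forall A B : sys T, reversible (swap A B);
  ax_tval_scal : forall r, tval (tscal r (idt (@sI T))) = r;
  ax_tval_repr : forall x : Tr T sI sI, x = tscal (tval x) (idt (@sI T));
  ax_prob_range : forall x : Tr T sI sI, phys x -> 0 <= tval x <= 1;
  ax_prob_sum : forall l : list (Tr T sI sI), test l -> sumR (map tval l) = 1;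
  ax_test_id : forall A : sys T, test [idt A];
  ax_test_seq : forall A B C (l1 : list (Tr T A B)) (l2 : list (Tr T B C)),
      test l1 -> test l2 -> test (seq_test l1 l2);
  ax_test_par : forall A B C D (l1 : list (Tr T A B)) (l2 : list (Tr T C D)),
      test l1 -> test l2 -> test (par_test l1 l2);
  ax_test_cgrain : forall A B (l : list (Tr T A B)) (f : nat -> nat) (m : nat),
      test l ->
      (forall i, (i < length l)%nat -> (f i < m)%nat) ->
      (forall j, (j < m)%nat -> exists i, (i < length l)%nat /\ f i = j) ->
      test (cgrain l f m);
  ax_test_cond : forall A B C (l1 : list (Tr T A B)) (L : nat -> list (Tr T B C)),
      test l1 -> (forall i, (i < length l1)%nat -> test (L i)) -> test (cond_test l1 L);
  ax_sep_state : forall A (x y : Tr T sI A),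
      (forall a : Tr T A sI, phys a -> seqc a x = seqc a y) -> x = y;
  ax_sep_effect : forall A (a b : Tr T A sI),
      (forall rho : Tr T sI A, phys rho -> seqc a rho = seqc b rho) -> a = b;
  ax_sep_transf : forall A B (C C' : Tr T A B),
      (forall S (Psi : Tr T sI (cmp A S)), phys Psi ->
         seqc (par C (idt S)) Psi = seqc (par C' (idt S)) Psi) -> C = C';
  ax_eff_test : forall A : sys T, test [eff A];
  ax_eff_unique : forall A (a : Tr T A sI), test [a] -> a = eff A;
  ax_eff_cmp : forall A B : sys T, eff (cmp A B) = seqc (runit sI) (par (eff A) (eff B));
  ax_local_discr : forall A B (x y : Tr T sI (cmp A B)), phys x -> phys y ->
      (forall (a : Tr T A sI) (b : Tr T B sI), phys a -> phys b ->
         prob (seqc (runit sI) (par a b)) x = prob (seqc (runit sI) (par a b)) y) -> x = y;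
  ax_closed : forall A (s : nat -> Tr T sI A) (x : Tr T sI A),
      (forall n, phys (s n)) ->
      (forall a : Tr T A sI, phys a -> Un_cv (fun n => prob a (s n)) (prob a x)) ->
      phys x;
  ax_nondet : exists x : Tr T sI sI, phys x /\ 0 < tval x < 1;
  ax_convex : forall A B (C D : Tr T A B) p, phys C -> phys D -> 0 <= p <= 1 ->
      phys (tadd (tscal p C) (tscal (1 - p) D));
  ax_perf_dist : exists A (rho0 rho1 : Tr T sI A) (a0 a1 : Tr T A sI),
      normalized rho0 /\ normalized rho1 /\ test [a0; a1] /\
      prob a0 rho0 = 1 /\ prob a1 rho1 = 1 /\ prob a0 rho1 = 0 /\ prob a1 rho0 = 0
}.

Definition Purification (T : OPTdata) : Prop :=
  (forall (A : sys T) (rho : Tr T sI A), normalized rho ->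
     exists (B : sys T) (Psi : Tr T sI (cmp A B)),
       pure Psi /\ normalized Psi /\ marginal Psi = rho) /\
  (forall (A B : sys T) (Psi Psi' : Tr T sI (cmp A B)),
     pure Psi -> normalized Psi -> pure Psi' -> normalized Psi' ->
     marginal Psi = marginal Psi' ->
     exists U : Tr T B B, reversible U /\ Psi' = seqc (par (idt A) U) Psi).

(* Main.v *)
(** Purify the input state [rho] to [Phi]. A test that disturbs no refinement of [rho] fixes
    [Phi] when applied locally, by local discriminability, because the slices of [Phi] by
    effects on the purifying system refine [rho]; as [Phi] is pure, each outcome of the test
    then multiplies [Phi] by a constant. To read this off on a given refinement [sigma] of
    [rho], [Phi] is chosen as a purification of the state in which a flag system tells
    [sigma] from the rest of [rho]. Since [rho] itself is a slice of every such [Phi], the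
    constant does not depend on [sigma]. *)

Require Import Defs.
From Stdlib Require Import Reals List.
From Stdlib Require Import Lia Lra Bool.
Import ListNotations.

Local Infix "⊕" := tadd (at level 50, left associativity).
Local Infix "∘" := seqc (at level 40, left associativity).
Local Infix "⊗" := par (at level 36, left associativity).
Local Infix "•" := tscal (at level 37, right associativity).

Section Theory.

Context {T : OPTdata} (HT : OPTAxioms T).

Local Open Scope R_scope.

(** * Linear algebra of transformations *)

Lemma add_0r {A B : sys T} (x : Tr T A B) : x ⊕ tzero = x.
Proof. apply (ax_add_zero T HT). Qed.

Lemma add_comm {A B : sys T} (x y : Tr T A B) : x ⊕ y = y ⊕ x.
Proof. apply (ax_add_comm T HT). Qed.

Lemma add_assoc {A B : sys T} (x y z : Tr T A B) : x ⊕ (y ⊕ z) = x ⊕ y ⊕ z.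
Proof. apply (ax_add_assoc T HT). Qed.

Lemma add_0l {A B : sys T} (x : Tr T A B) : tzero ⊕ x = x.
Proof. rewrite add_comm; apply add_0r. Qed.

Lemma add_lcomm {A B : sys T} (x y z : Tr T A B) : x ⊕ (y ⊕ z) = y ⊕ (x ⊕ z).
Proof. rewrite !add_assoc, (add_comm x y); reflexivity. Qed.

Lemma add_cancel_l {A B : sys T} (x y z : Tr T A B) : x ⊕ y = x ⊕ z -> y = z.
Proof.
  intros E.
  rewrite <- (add_0l y), <- (add_0l z), <- (ax_add_opp T HT _ _ x), (add_comm x).
  rewrite <- !add_assoc, E; reflexivity.
Qed.

Lemma scal_1 {A B : sys T} (x : Tr T A B) : 1 • x = x.
Proof. apply (ax_scal_one T HT). Qed.

Lemma scal_mul {A B : sys T} r s (x : Tr T A B) : r • (s • x) = (r * s) • x.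
Proof. apply (ax_scal_mul T HT). Qed.

Lemma scal_0l {A B : sys T} (x : Tr T A B) : 0 • x = tzero.
Proof.
  replace 0 with (1 + -1) by ring.
  rewrite (ax_scal_addr T HT), scal_1; apply (ax_add_opp T HT).
Qed.

Lemma scal_0r {A B : sys T} r : r • (tzero : Tr T A B) = tzero.
Proof. rewrite <- (scal_0l tzero), scal_mul, Rmult_0_r; reflexivity. Qed.

Lemma scal_addv {A B : sys T} r (x y : Tr T A B) : r • (x ⊕ y) = r • x ⊕ r • y.
Proof. apply (ax_scal_addv T HT). Qed.

Lemma scal_inj {A B : sys T} r (x y : Tr T A B) : r <> 0 -> r • x = r • y -> x = y.
Proof.
  intros Hr E.
  rewrite <- (scal_1 x), <- (scal_1 y), <- (Rinv_l r Hr), <- !scal_mul, E; reflexivity.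
Qed.

Lemma seq_assoc {A B C D : sys T} (f : Tr T A B) (g : Tr T B C) (h : Tr T C D) :
  h ∘ (g ∘ f) = h ∘ g ∘ f.
Proof. apply (ax_seq_assoc T HT). Qed.

Lemma seq_idl {A B : sys T} (f : Tr T A B) : idt B ∘ f = f.
Proof. apply (ax_seq_idl T HT). Qed.

Lemma seq_idr {A B : sys T} (f : Tr T A B) : f ∘ idt A = f.
Proof. apply (ax_seq_idr T HT). Qed.

Lemma seq_addl {A B C : sys T} (g g' : Tr T B C) (f : Tr T A B) :
  (g ⊕ g') ∘ f = g ∘ f ⊕ g' ∘ f.
Proof. apply (ax_seq_addl T HT). Qed.

Lemma seq_addr {A B C : sys T} (g : Tr T B C) (f f' : Tr T A B) :
  g ∘ (f ⊕ f') = g ∘ f ⊕ g ∘ f'.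
Proof. apply (ax_seq_addr T HT). Qed.

Lemma seq_scall {A B C : sys T} r (g : Tr T B C) (f : Tr T A B) :
  (r • g) ∘ f = r • (g ∘ f).
Proof. apply (ax_seq_scall T HT). Qed.

Lemma seq_scalr {A B C : sys T} r (g : Tr T B C) (f : Tr T A B) :
  g ∘ (r • f) = r • (g ∘ f).
Proof. apply (ax_seq_scalr T HT). Qed.

Lemma seq_0l {A B C : sys T} (f : Tr T A B) : (tzero : Tr T B C) ∘ f = tzero.
Proof. rewrite <- (scal_0l tzero), seq_scall; apply scal_0l. Qed.

Lemma seq_0r {A B C : sys T} (g : Tr T B C) : g ∘ (tzero : Tr T A B) = tzero.
Proof. rewrite <- (scal_0l tzero), seq_scalr; apply scal_0l. Qed.

Lemma par_0l {A B C D : sys T} (g : Tr T C D) : (tzero : Tr T A B) ⊗ g = tzero.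
Proof.
  rewrite <- (scal_0l (tzero : Tr T A B)), (ax_par_scall T HT); apply scal_0l.
Qed.

Lemma par_seq {A B C A' B' C' : sys T}
  (f : Tr T A B) (g : Tr T B C) (f' : Tr T A' B') (g' : Tr T B' C') :
  (g ⊗ g') ∘ (f ⊗ f') = (g ∘ f) ⊗ (g' ∘ f').
Proof. symmetry; apply (ax_par_seq T HT). Qed.

(** * Scalars as real numbers *)

Lemma tval_add (x y : Tr T sI sI) : tval (x ⊕ y) = tval x + tval y.
Proof.
  rewrite (ax_tval_repr T HT x), (ax_tval_repr T HT y) at 1.
  rewrite <- (ax_scal_addr T HT); apply (ax_tval_scal T HT).
Qed.

Lemma tval_scal r (x : Tr T sI sI) : tval (r • x) = r * tval x.
Proof.
  rewrite (ax_tval_repr T HT x) at 1.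
  rewrite scal_mul; apply (ax_tval_scal T HT).
Qed.

Lemma tval_0 : tval (tzero : Tr T sI sI) = 0.
Proof. rewrite <- (scal_0l (tzero : Tr T sI sI)), tval_scal; ring. Qed.

Lemma tval_inj (x y : Tr T sI sI) : tval x = tval y -> x = y.
Proof.
  intros E; rewrite (ax_tval_repr T HT x), (ax_tval_repr T HT y), E; reflexivity.
Qed.

Lemma tval_id : tval (idt (@sI T)) = 1.
Proof. rewrite <- (scal_1 (idt _)); apply (ax_tval_scal T HT). Qed.

Lemma seq_scalar {A : sys T} (f : Tr T sI A) (t : Tr T sI sI) : f ∘ t = tval t • f.
Proof. rewrite (ax_tval_repr T HT t) at 1; rewrite seq_scalr, seq_idr; reflexivity. Qed.

(** * Finite sums and sums over selected outcomes *)

Lemma tsum_map_seq {A B C : sys T} (l : list (Tr T B C)) (f : Tr T A B) :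
  tsum (map (fun a => a ∘ f) l) = tsum l ∘ f.
Proof.
  induction l as [|a l IH]; cbn.
  - symmetry; apply seq_0l.
  - fold (tsum l); rewrite seq_addl, <- IH; reflexivity.
Qed.

Lemma seq_tsum {A B C : sys T} (g : Tr T B C) (l : list (Tr T A B)) :
  g ∘ tsum l = tsum (map (fun a => g ∘ a) l).
Proof.
  induction l as [|a l IH]; cbn.
  - apply seq_0r.
  - fold (tsum l); rewrite seq_addr, IH; reflexivity.
Qed.

Lemma tsum_app {A B : sys T} (l1 l2 : list (Tr T A B)) :
  tsum (l1 ++ l2) = tsum l1 ⊕ tsum l2.
Proof.
  induction l1 as [|a l1 IH]; cbn.
  - symmetry; apply add_0l.
  - fold (tsum l1) (tsum (l1 ++ l2)); rewrite IH; apply add_assoc.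
Qed.

Lemma tval_tsum (l : list (Tr T sI sI)) : tval (tsum l) = sumR (map tval l).
Proof.
  induction l as [|a l IH]; cbn.
  - apply tval_0.
  - fold (tsum l); rewrite tval_add, IH; reflexivity.
Qed.

(** Peeling off the head shifts the selector; this recursion lets the facts about [tsum_sel] below
    be proved by induction on the list. *)
Lemma tsum_sel_cons {A B : sys T} (a : Tr T A B) l Y :
  tsum_sel (a :: l) Y = (if Y 0%nat then a else tzero) ⊕ tsum_sel l (fun i => Y (S i)).
Proof.
  unfold tsum_sel; cbn [length seq filter].
  rewrite <- seq_shift, filter_map_swap.
  destruct (Y 0%nat); cbn [map tsum fold_right]; rewrite map_map; cbn [tnth nth].
  - reflexivity.
  - rewrite add_0l; reflexivity.
Qed.

Lemma tsum_sel_all {A B : sys T} (l : list (Tr T A B)) : tsum_sel l (fun _ => true) = tsum l.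
Proof.
  induction l as [|a l IH]; [reflexivity|].
  rewrite tsum_sel_cons, IH; reflexivity.
Qed.

Lemma tsum_sel_ext {A B : sys T} (l : list (Tr T A B)) Y Z :
  (forall i, Y i = Z i) -> tsum_sel l Y = tsum_sel l Z.
Proof.
  revert Y Z; induction l as [|a l IH]; intros Y Z E; [reflexivity|].
  rewrite !tsum_sel_cons, E, (IH (fun i => Y (S i)) (fun i => Z (S i))); auto.
Qed.

Lemma tsum_sel_or {A B : sys T} (l : list (Tr T A B)) Y Z :
  (forall i, Y i && Z i = false) ->
  tsum_sel l (fun i => Y i || Z i) = tsum_sel l Y ⊕ tsum_sel l Z.
Proof.
  revert Y Z; induction l as [|a l IH]; intros Y Z E; [symmetry; apply add_0l|].
  rewrite !tsum_sel_cons, (IH (fun i => Y (S i)) (fun i => Z (S i))); auto.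
  specialize (E 0%nat); destruct (Y 0%nat), (Z 0%nat); cbn in *; try discriminate;
    rewrite ?add_0l, <- ?add_assoc; auto using add_lcomm.
Qed.

Lemma tsum_sel_none {A B : sys T} (l : list (Tr T A B)) Y :
  (forall i, Y i = false) -> tsum_sel l Y = tzero.
Proof.
  revert Y; induction l as [|a l IH]; intros Y E; [reflexivity|].
  rewrite tsum_sel_cons, E, IH; auto using add_0l.
Qed.

(** Out of range both sides are [tzero], the default value of [tnth]. *)
Lemma tsum_sel_single {A B : sys T} (l : list (Tr T A B)) j :
  tsum_sel l (fun i => Nat.eqb i j) = tnth l j.
Proof.
  revert j; induction l as [|a l IH]; intros [|j]; try reflexivity.
  - rewrite tsum_sel_cons, tsum_sel_none; auto using add_0r.
  - rewrite tsum_sel_cons; cbn; rewrite add_0l; apply IH.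
Qed.

(** * Physical transformations and one-outcome tests *)

Lemma phys_in {A B : sys T} (l : list (Tr T A B)) f : test l -> In f l -> phys f.
Proof. exists l; auto. Qed.

Lemma phys_tnth {A B : sys T} (l : list (Tr T A B)) i :
  test l -> (i < length l)%nat -> phys (tnth l i).
Proof. intros Hl Hi; apply (phys_in l _ Hl), nth_In, Hi. Qed.

Lemma phys_test1 {A B : sys T} (f : Tr T A B) : test [f] -> phys f.
Proof. intros H; apply (phys_in _ _ H); left; reflexivity. Qed.

Lemma phys_id (A : sys T) : phys (idt A).
Proof. apply phys_test1, (ax_test_id T HT). Qed.

Lemma phys_eff (A : sys T) : phys (eff A).
Proof. apply phys_test1, (ax_eff_test T HT). Qed.

Lemma phys_seq {A B C : sys T} (g : Tr T B C) (f : Tr T A B) :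
  phys g -> phys f -> phys (g ∘ f).
Proof.
  intros [lg [Hg Ig]] [lf [Hf If]].
  apply (phys_in (seq_test lf lg)); [apply (ax_test_seq T HT); assumption|].
  apply in_flat_map; exists g; split; [assumption|].
  apply (in_map (fun b => g ∘ b)); assumption.
Qed.

Lemma phys_par {A B C D : sys T} (f : Tr T A B) (g : Tr T C D) :
  phys f -> phys g -> phys (f ⊗ g).
Proof.
  intros [lf [Hf If]] [lg [Hg Ig]].
  apply (phys_in (par_test lf lg)); [apply (ax_test_par T HT); assumption|].
  apply in_flat_map; exists f; split; [assumption|].
  apply (in_map (fun b => f ⊗ b)); assumption.
Qed.

(** Coarse-graining into a single block; [l] is nonempty because every block has to be hit. *)
Lemma test_tsum {A B : sys T} (l : list (Tr T A B)) : test l -> l <> [] -> test [tsum l].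
Proof.
  intros Hl Hn.
  replace [tsum l] with (cgrain l (fun _ => 0%nat) 1).
  - apply (ax_test_cgrain T HT); [assumption|lia|].
    intros j Hj; exists 0%nat; destruct l; [congruence|]; cbn; lia.
  - cbn; rewrite <- tsum_sel_all; reflexivity.
Qed.

Lemma test_seq1 {A B C : sys T} (f : Tr T A B) (g : Tr T B C) :
  test [f] -> test [g] -> test [g ∘ f].
Proof. exact (ax_test_seq T HT _ _ _ [f] [g]). Qed.

Lemma test_par1 {A B C D : sys T} (f : Tr T A B) (g : Tr T C D) :
  test [f] -> test [g] -> test [f ⊗ g].
Proof. exact (ax_test_par T HT _ _ _ _ [f] [g]). Qed.

Lemma in_not_nil {X : Type} (x : X) l : In x l -> l <> [].
Proof. intros H E; rewrite E in H; exact H. Qed.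

(** * Consequences of causality *)

Lemma prob_nonneg {A : sys T} (a : Tr T A sI) (rho : Tr T sI A) :
  phys a -> phys rho -> 0 <= prob a rho.
Proof. intros Ha Hr; apply (ax_prob_range T HT), phys_seq; assumption. Qed.

Lemma sumR_nonneg (l : list R) : Forall (fun x => 0 <= x) l -> 0 <= sumR l.
Proof. unfold sumR; induction 1; cbn; lra. Qed.

Lemma sumR_eq_0 (l : list R) :
  Forall (fun x => 0 <= x) l -> sumR l = 0 -> Forall (fun x => x = 0) l.
Proof.
  induction 1 as [|x l Hx Hl IH]; cbn; intros E; constructor;
    pose proof (sumR_nonneg l Hl); fold (sumR l) in E; [lra|apply IH; lra].
Qed.

Lemma tsum_eq_0 (l : list (Tr T sI sI)) f :
  Forall phys l -> tsum l = tzero -> In f l -> f = tzero.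
Proof.
  intros Hl E Hf; apply tval_inj; rewrite tval_0.
  assert (H : Forall (fun x => x = 0) (map tval l)).
  { apply sumR_eq_0; [|rewrite <- tval_tsum, E; apply tval_0].
    apply Forall_map; eapply Forall_impl, Hl; apply (ax_prob_range T HT). }
  rewrite Forall_map, Forall_forall in H; auto.
Qed.

(** Any effect sits in an observation test, whose sum is [eff A] by uniqueness; its nonnegative
    probabilities on [x] therefore sum to zero. *)
Lemma state_eq_0 {A : sys T} (x : Tr T sI A) : phys x -> prob (eff A) x = 0 -> x = tzero.
Proof.
  intros Hx E; apply (ax_sep_state T HT); intros a [l [Hl Ha]].
  rewrite seq_0r.
  apply (tsum_eq_0 (map (fun b => b ∘ x) l)).
  - apply Forall_map, Forall_forall; intros b Hb.
    apply phys_seq; [apply (phys_in l)|]; assumption.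
  - rewrite tsum_map_seq, (ax_eff_unique T HT _ (tsum l)).
    + apply tval_inj; rewrite tval_0; exact E.
    + apply test_tsum; [|apply (in_not_nil a)]; assumption.
  - apply (in_map (fun b => b ∘ x)); assumption.
Qed.

(** Separation of transformations reduces the claim to the outputs of [t ⊗ idt S], which have total
    probability zero since the deterministic effect factorizes. *)
Lemma phys_eq_0 {A B : sys T} (t : Tr T A B) : phys t -> eff B ∘ t = tzero -> t = tzero.
Proof.
  intros Ht E; apply (ax_sep_transf T HT); intros S Psi HPsi.
  rewrite par_0l, seq_0l; apply state_eq_0.
  - apply phys_seq; [apply phys_par; [|apply phys_id]|]; assumption.
  - unfold prob; rewrite (ax_eff_cmp T HT), seq_assoc, <- (seq_assoc _ (eff B ⊗ _)).
    rewrite par_seq, E, par_0l, seq_0r, seq_0l; apply tval_0.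
Qed.

(** The sum of a test containing [C] also preserves the deterministic effect, so the other outcomes
    have total probability zero and vanish. Hence [C] is that sum. *)
Lemma channel_test {A B : sys T} (C : Tr T A B) : channel C -> test [C].
Proof.
  intros [[l [Hl HC]] E].
  assert (HS : test [tsum l]) by (apply test_tsum; [|apply (in_not_nil C)]; assumption).
  assert (ES : eff B ∘ tsum l = eff A)
    by (apply (ax_eff_unique T HT), test_seq1; [|apply (ax_eff_test T HT)]; assumption).
  destruct (in_split _ _ HC) as [l1 [l2 El]].
  assert (EC : tsum l = C ⊕ tsum (l1 ++ l2)).
  { rewrite El, !tsum_app; cbn; fold (tsum l2); apply add_lcomm. }
  assert (E0 : eff B ∘ tsum (l1 ++ l2) = tzero).
  { apply (add_cancel_l (eff A)); rewrite add_0r; rewrite <- E at 1.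
    rewrite <- seq_addr, <- EC; exact ES. }
  assert (H0 : tsum (l1 ++ l2) = tzero).
  { assert (F : forall f, In f (l1 ++ l2) -> f = tzero).
    { intros f Hf.
      assert (Hp : forall g, In g (l1 ++ l2) -> phys g).
      { intros g Hg; apply (phys_in l); [assumption|].
        rewrite El; apply in_app_iff in Hg; apply in_app_iff; cbn; tauto. }
      apply phys_eq_0; [auto|].
      apply (ax_sep_effect T HT); intros r Hr; rewrite seq_0l.
      apply (tsum_eq_0 (map (fun g => eff B ∘ g ∘ r) (l1 ++ l2))).
      - apply Forall_map, Forall_forall; intros g Hg.
        apply phys_seq; [apply phys_seq; [apply phys_eff|]|]; auto.
      - rewrite <- (map_map (fun g => eff B ∘ g) (fun h => h ∘ r)).
        rewrite tsum_map_seq, <- seq_tsum, E0; apply seq_0l.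
      - apply (in_map (fun g => eff B ∘ g ∘ r)); assumption. }
    clear EC; induction (l1 ++ l2) as [|f m IH]; [reflexivity|].
    cbn; fold (tsum m); rewrite (F f), add_0l by (left; reflexivity).
    apply IH.
    - cbn in E0; fold (tsum m) in E0.
      rewrite (F f), add_0l in E0 by (left; reflexivity); exact E0.
    - intros g Hg; apply F; right; exact Hg. }
  rewrite EC, H0, add_0r in HS; exact HS.
Qed.

Lemma eff_sI : eff (@sI T) = idt sI.
Proof. symmetry; apply (ax_eff_unique T HT), (ax_test_id T HT). Qed.

Lemma normalized_test {A : sys T} (x : Tr T sI A) : normalized x -> test [x].
Proof.
  intros [Hx E]; apply channel_test; split; [assumption|].
  rewrite eff_sI; apply tval_inj; rewrite tval_id; exact E.
Qed.

(** * Impossible outcomes; splitting and merging tests *)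

(** Preparing [r1] and then discriminating it from [r0] gives an outcome that never occurs and one
    that always does. *)
Lemma test_zero_one : test [tzero; idt (@sI T)].
Proof.
  destruct (ax_perf_dist T HT) as (A & r0 & r1 & a0 & a1 & _ & H1 & Ha & _ & E1 & E0 & _).
  assert (H : test (seq_test [r1] [a0; a1]))
    by (apply (ax_test_seq T HT); [apply normalized_test|]; assumption).
  cbn in H.
  replace (a0 ∘ r1) with (tzero : Tr T sI sI) in H
    by (apply tval_inj; rewrite tval_0; symmetry; exact E0).
  replace (a1 ∘ r1) with (idt (@sI T)) in H
    by (apply tval_inj; rewrite tval_id; symmetry; exact E1).
  exact H.
Qed.

(** [test_zero_one] is run in parallel with [A], the trivial system being attached by the inverse of
    [lunit A] and removed again. *)
Lemma test_zero_id (A : sys T) : test [tzero; idt A].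
Proof.
  destruct (ax_lunit_rev T HT A) as [HU [W [HW [_ E]]]].
  pose proof (ax_test_par T HT _ _ _ _ _ _ test_zero_one (ax_test_id T HT A)) as H.
  apply (ax_test_seq T HT _ _ _ [W]) in H; [|apply channel_test; assumption].
  apply (fun H => ax_test_seq T HT _ _ _ _ [lunit A] H (channel_test _ HU)) in H.
  cbn in H.
  rewrite par_0l, seq_0l, seq_0r, (ax_par_id T HT), seq_idl, E in H; exact H.
Qed.

(** Conditioning on [[tzero; idt A]]: the impossible outcome is followed by the coarse-grained
    [[tsum l]], the certain one by [l]. *)
Lemma test_cons_zero {A B : sys T} (l : list (Tr T A B)) :
  test l -> l <> [] -> test (tzero :: l).
Proof.
  intros Hl Hn.
  assert (H : test (cond_test [tzero; idt A] (fun i => match i with O => [tsum l] | _ => l end))).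
  { apply (ax_test_cond T HT); [apply test_zero_id|].
    intros [|i] _; [apply test_tsum|]; assumption. }
  cbn in H; rewrite seq_0r, app_nil_r in H.
  rewrite (map_ext _ (fun c => c)), map_id in H; [exact H|intros; apply seq_idr].
Qed.

(** Coarse-graining needs nonempty blocks, and either of the last two may be empty; two zero
    outcomes are prepended to fill them. *)
Lemma test_split {A B : sys T} (l : list (Tr T A B)) j Y :
  test l -> (j < length l)%nat ->
  test [tnth l j; tsum_sel l (fun i => negb (Nat.eqb i j) && Y i);
        tsum_sel l (fun i => negb (Nat.eqb i j) && negb (Y i))].
Proof.
  intros Hl Hj.
  (* Indices 0 and 1 are the padding, sent to blocks 1 and 2; index [k + 2] is the original outcome
     [k]. *)
  set (f := fun i => match i with
                     | 0 => 1 | 1 => 2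
                     | S (S k) => if Nat.eqb k j then 0 else if Y k then 1 else 2
                     end%nat).
  assert (H : test (cgrain (tzero :: tzero :: l) f 3)).
  { apply (ax_test_cgrain T HT).
    - apply test_cons_zero; [apply test_cons_zero|discriminate]; [assumption|].
      intros ->; cbn in Hj; lia.
    - intros [|[|i]] _; cbn; [lia|lia|destruct (Nat.eqb i j), (Y i); lia].
    - intros [|[|[|k]]] Hk; [exists (S (S j))|exists 0%nat|exists 1%nat|lia]; cbn;
        rewrite ?Nat.eqb_refl; split; auto; lia. }
  unfold cgrain in H; cbn [map seq] in H; rewrite !tsum_sel_cons in H; cbn in H.
  rewrite !add_0l in H.
  rewrite <- (tsum_sel_single l j).
  match goal with |- test [?a; ?b; ?c] => match type of H with test [?a'; ?b'; ?c'] =>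
    replace a with a'; [replace b with b'; [replace c with c'; [exact H|]|]|] end end;
  apply tsum_sel_ext; intros i; destruct (Nat.eqb i j), (Y i); reflexivity.
Qed.

Lemma test_merge_l {A B : sys T} (D X Y : Tr T A B) : test [D; X; Y] -> test [D ⊕ X; Y].
Proof.
  intros H.
  assert (H' : test (cgrain [D; X; Y] (fun i => match i with 2 => 1 | _ => 0 end)%nat 2)).
  { apply (ax_test_cgrain T HT); [assumption| |].
    - intros [|[|[|i]]] _; lia.
    - intros [|[|i]] Hi; [exists 0%nat|exists 2%nat|lia]; cbn; split; auto; lia. }
  cbn in H'; unfold tsum_sel in H'; cbn in H'; rewrite !add_0r in H'; exact H'.
Qed.

Lemma test_merge_r {A B : sys T} (D X Y : Tr T A B) : test [D; X; Y] -> test [D; X ⊕ Y].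
Proof.
  intros H.
  assert (H' : test (cgrain [D; X; Y] (fun i => match i with 0 => 0 | _ => 1 end)%nat 2)).
  { apply (ax_test_cgrain T HT); [assumption| |].
    - intros [|i] _; lia.
    - intros [|[|i]] Hi; [exists 0%nat|exists 2%nat|lia]; cbn; split; auto; lia. }
  cbn in H'; unfold tsum_sel in H'; cbn in H'; rewrite !add_0r in H'; exact H'.
Qed.

Lemma test_tnth_compl {A B : sys T} (l : list (Tr T A B)) j :
  test l -> (j < length l)%nat -> exists f, test [tnth l j; f] /\ tnth l j ⊕ f = tsum l.
Proof.
  intros Hl Hj; pose proof (test_split l j (fun _ => true) Hl Hj) as H.
  rewrite (tsum_sel_none l (fun i => _ && negb true)) in H by (intros; apply andb_false_r).
  eexists; split; [exact (test_merge_r _ _ _ H)|].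
  rewrite add_0r, <- tsum_sel_all, <- (tsum_sel_single l j), <- tsum_sel_or.
  - apply tsum_sel_ext; intros i; destruct (Nat.eqb i j); reflexivity.
  - intros i; destruct (Nat.eqb i j); reflexivity.
Qed.

Lemma phys_compl {A B : sys T} (f : Tr T A B) : phys f -> exists g, test [f; g].
Proof.
  intros [l [Hl Hf]]; destruct (In_nth l f tzero Hf) as [j [Hj E]].
  destruct (test_tnth_compl l j Hl Hj) as [g [Hg _]].
  exists g; unfold tnth in Hg; rewrite E in Hg; exact Hg.
Qed.

Lemma test2_sum {A B : sys T} (f g : Tr T A B) : test [f; g] -> test [f ⊕ g].
Proof.
  intros H; apply test_tsum in H; [|discriminate].
  cbn in H; rewrite add_0r in H; exact H.
Qed.

Lemma effect_compl {A : sys T} (a : Tr T A sI) :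
  phys a -> exists b, test [a; b] /\ a ⊕ b = eff A.
Proof.
  intros Ha; destruct (phys_compl a Ha) as [b Hb].
  exists b; split; [assumption|]; apply (ax_eff_unique T HT), test2_sum, Hb.
Qed.

(** * Refinement *)

(** A normal form: the rest of [C] is merged into [X], the rest of the test into [Y]. *)
Lemma refinesE {A B : sys T} (D C : Tr T A B) :
  refines D C <-> exists X Y, test [D; X; Y] /\ C = D ⊕ X.
Proof.
  split.
  - intros (l & Y0 & Hl & EC & j & Hj & HY & ED).
    do 2 eexists; split; [rewrite ED; exact (test_split l j Y0 Hl Hj)|].
    rewrite EC, ED, <- (tsum_sel_single l j), <- tsum_sel_or.
    + apply tsum_sel_ext; intros i; destruct (Nat.eqb_spec i j) as [->|]; cbn; auto.
    + intros i; destruct (Nat.eqb i j); reflexivity.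
  - intros (X & Y & H & EC).
    exists [D; X; Y], (fun i => Nat.ltb i 2); split; [assumption|split].
    + rewrite EC; unfold tsum_sel; cbn; rewrite add_0r; reflexivity.
    + exists 0%nat; cbn; repeat split; lia.
Qed.

Lemma refines_phys_l {A B : sys T} (D C : Tr T A B) : refines D C -> phys D.
Proof.
  rewrite refinesE; intros (X & Y & H & _); apply (phys_in _ _ H); left; reflexivity.
Qed.

Lemma refines_phys_r {A B : sys T} (D C : Tr T A B) : refines D C -> phys C.
Proof.
  rewrite refinesE; intros (X & Y & H & ->).
  apply (phys_in _ _ (test_merge_l _ _ _ H)); left; reflexivity.
Qed.

Lemma refines_test1 {A B : sys T} (C : Tr T A B) : test [C] -> refines C C.
Proof.
  intros H; exists [C], (fun _ => true); split; [assumption|split].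
  - unfold tsum_sel; cbn; rewrite add_0r; reflexivity.
  - exists 0%nat; cbn; auto.
Qed.

(** Composing the refining test with [[f; g]] splits each piece in two; [f ∘ D] is one of the pieces
    of the total. *)
Lemma refines_seq_l {A B C : sys T} (f g : Tr T B C) (D E : Tr T A B) :
  test [f; g] -> refines D E -> refines (f ∘ D) ((f ⊕ g) ∘ E).
Proof.
  intros Hfg; rewrite (refinesE D E); intros (X & Y & H & ->).
  (* The outcomes are [f ∘ D], [f ∘ X], [f ∘ Y], then the same with [g]; all but those with [Y] are
     kept. *)
  exists (seq_test [D; X; Y] [f; g]),
    (fun i => match i with 0 | 1 | 3 | 4 => true | _ => false end%nat).
  split; [apply (ax_test_seq T HT); assumption|split].
  - unfold tsum_sel; cbn; rewrite add_0r, seq_addl, !seq_addr, <- add_assoc; reflexivity.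
  - exists 0%nat; cbn; repeat split; lia.
Qed.

(** Used with a scalar [t] to rescale a refinement. *)
Lemma refines_seq_r {A B C : sys T} (t : Tr T A B) (D E : Tr T B C) :
  phys t -> refines D E -> refines (D ∘ t) (E ∘ t).
Proof.
  intros Ht; destruct (phys_compl t Ht) as [t' Ht'].
  rewrite (refinesE D E); intros (X & Y & H & ->).
  (* The outcomes start with [D ∘ t], [D ∘ t'], [X ∘ t], [X ∘ t']; positions 0 and 2 are kept. *)
  exists (seq_test [t; t'] [D; X; Y]),
    (fun i => match i with 0 | 2 => true | _ => false end%nat).
  split; [apply (ax_test_seq T HT); assumption|split].
  - unfold tsum_sel; cbn; rewrite add_0r, seq_addl; reflexivity.
  - exists 0%nat; cbn; repeat split; lia.
Qed.

(** * Normalization of states *)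

(* Repeating the preparation of [x] until it succeeds. *)
Lemma phys_geometric {A : sys T} (x : Tr T sI A) n :
  phys x -> prob (eff A) x <> 0 ->
  phys (((1 - (1 - prob (eff A) x) ^ S n) / prob (eff A) x) • x).
Proof.
  intros Hx Hp; set (p := prob (eff A) x) in *.
  induction n as [|n IH].
  - replace ((1 - (1 - p) ^ 1) / p) with 1 by (field; assumption).
    rewrite scal_1; assumption.
  (* [s] is the geometric sum of [(1 - p) ^ k] over [k <= n], the weight with which [n + 1] attempts
     yield [x]. *)
  - set (s := (1 - (1 - p) ^ S n) / p) in *.
    destruct (phys_compl x Hx) as [y Hxy], (phys_compl _ IH) as [z Hz].
    assert (Hy : prob (eff A) y = 1 - p).
    { pose proof (ax_prob_sum T HT _
        (ax_test_seq T HT _ _ _ _ _ Hxy (ax_eff_test T HT A))) as E.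
      cbn in E; fold (prob (eff A) x) (prob (eff A) y) p in E; lra. }
    (* On success the state is kept; on failure [y] is discarded by [eff A] and the earlier
       procedure is run. *)
    assert (H : test (cond_test [x; y]
      (fun i => match i with O => [idt A] | _ => seq_test [eff A] [s • x; z] end))).
    { apply (ax_test_cond T HT); [assumption|]; intros [|i] _.
      - apply (ax_test_id T HT).
      - apply (ax_test_seq T HT); [apply (ax_eff_test T HT)|assumption]. }
    cbn in H; apply test_merge_l in H.
    rewrite seq_idl, <- (seq_assoc y (eff A) (s • x)), seq_scalar in H.
    fold (prob (eff A) y) in H; rewrite Hy, scal_mul in H.
    replace (x ⊕ ((1 - p) * s) • x)
      with (((1 - (1 - p) ^ S (S n)) / p) • x) in H.
    + apply (phys_in _ _ H); left; reflexivity.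
    + rewrite <- (scal_1 x) at 2; rewrite <- (ax_scal_addr T HT).
      f_equal; unfold s; cbn; field; assumption.
Qed.

(** The weights of [phys_geometric] tend to [/ prob (eff A) x], and sets of states are closed. *)
Lemma phys_normalize {A : sys T} (x : Tr T sI A) :
  phys x -> prob (eff A) x <> 0 -> phys ((/ prob (eff A) x) • x).
Proof.
  intros Hx Hp; pose proof (ax_prob_range T HT _ (phys_seq _ _ (phys_eff A) Hx)) as Hr.
  fold (prob (eff A) x) in Hr.
  pose proof (fun n => phys_geometric x n Hx Hp) as H.
  set (p := prob (eff A) x) in *.
  apply (ax_closed T HT A _ _ H); intros a Ha; unfold prob.
  rewrite seq_scalr, tval_scal; fold (prob a x).
  assert (Hq : Rabs (1 - p) < 1) by (rewrite Rabs_right; lra).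
  assert (L : Un_cv (fun n => (1 - p) ^ S n) 0).
  { intros eps He; destruct (pow_lt_1_zero _ Hq eps He) as [N HN].
    exists N; intros n Hn; unfold Rdist; rewrite Rminus_0_r; apply HN; lia. }
  assert (L' : Un_cv (fun n => (1 - (1 - p) ^ S n) * (/ p * prob a x)) (/ p * prob a x)).
  { rewrite <- (Rmult_1_l (/ p * prob a x)) at 1.
    apply (CV_mult _ (fun _ => / p * prob a x)).
    - rewrite <- (Rminus_0_r 1) at 1; apply (CV_minus (fun _ => 1)); [|exact L].
      intros eps He; exists 0%nat; intros; rewrite Rdist_eq; exact He.
    - intros eps He; exists 0%nat; intros; rewrite Rdist_eq; exact He. }
  intros eps He; destruct (L' eps He) as [N HN]; exists N; intros n Hn.
  rewrite seq_scalr, tval_scal; fold (prob a x).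
  replace ((1 - (1 - p) ^ S n) / p * prob a x)
    with ((1 - (1 - p) ^ S n) * (/ p * prob a x)) by (unfold Rdiv; ring).
  apply HN; assumption.
Qed.

(** * Slices of bipartite states and local discriminability *)

(** Sends a bipartite state to the unnormalized conditional state on [A] when [b] is observed on
    [B]; for [b = eff B] this is the marginal. *)
Definition slice (A : sys T) {B : sys T} (b : Tr T B sI) : Tr T (cmp A B) A :=
  runit A ∘ (idt A ⊗ b).

Lemma slice_nat {A A' B : sys T} (f : Tr T A A') (b : Tr T B sI) :
  f ∘ slice A b = slice A' b ∘ (f ⊗ idt B).
Proof.
  unfold slice.
  rewrite seq_assoc, <- (ax_runit_nat T HT), <- !seq_assoc, !par_seq.
  rewrite !seq_idl, !seq_idr; reflexivity.
Qed.

Lemma product_effect_slice {A B : sys T} (a : Tr T A sI) (b : Tr T B sI) :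
  runit sI ∘ (a ⊗ b) = a ∘ slice A b.
Proof.
  unfold slice; rewrite seq_assoc, <- (ax_runit_nat T HT), <- seq_assoc, par_seq.
  rewrite seq_idl, seq_idr; reflexivity.
Qed.

Lemma test_runit (A : sys T) : test [runit A].
Proof. apply channel_test, (ax_runit_rev T HT). Qed.

Lemma phys_slice (A : sys T) {B : sys T} (b : Tr T B sI) : phys b -> phys (slice A b).
Proof.
  intros Hb; apply phys_seq; [apply phys_test1, test_runit|].
  apply phys_par; [apply phys_id|assumption].
Qed.

Lemma marginal_slice {A B : sys T} (Psi : Tr T sI (cmp A B)) :
  marginal Psi = slice A (eff B) ∘ Psi.
Proof. apply seq_assoc. Qed.

(** Completing [b] to a test with sum [eff B] makes slicing by [b] one outcome of taking the
    marginal. *)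
Lemma refines_slice {A B : sys T} (b : Tr T B sI) (D E : Tr T sI (cmp A B)) :
  phys b -> refines D E -> refines (slice A b ∘ D) (slice A (eff B) ∘ E).
Proof.
  intros Hb; destruct (effect_compl b Hb) as [b' [Ht <-]].
  replace (slice A (b ⊕ b')) with (slice A b ⊕ slice A b')
    by (unfold slice; rewrite (ax_par_addr T HT), seq_addr; reflexivity).
  apply refines_seq_l.
  pose proof (ax_test_par T HT _ _ _ _ _ _ (ax_test_id T HT A) Ht) as H.
  exact (ax_test_seq T HT _ _ _ _ _ H (test_runit A)).
Qed.

(** The product effect of [a] and [b] is [a] applied to the slice by [b], so the slices settle all
    product effects. *)
Lemma eq_of_slices {A B : sys T} (x y : Tr T sI (cmp A B)) :
  phys x -> phys y ->
  (forall b : Tr T B sI, phys b -> slice A b ∘ x = slice A b ∘ y) -> x = y.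
Proof.
  intros Hx Hy H; apply (ax_local_discr T HT); [assumption..|].
  intros a b Ha Hb; unfold prob.
  rewrite product_effect_slice, <- !seq_assoc, H by assumption; reflexivity.
Qed.

Lemma fixed_of_slices {A B : sys T} (f : Tr T A A) (x : Tr T sI (cmp A B)) :
  phys f -> phys x ->
  (forall b : Tr T B sI, phys b -> f ∘ (slice A b ∘ x) = slice A b ∘ x) ->
  (f ⊗ idt B) ∘ x = x.
Proof.
  intros Hf Hx H; apply eq_of_slices; [|assumption|].
  - apply phys_seq; [apply phys_par; [|apply phys_id]|]; assumption.
  - intros b Hb; rewrite seq_assoc, <- slice_nat, <- seq_assoc; auto.
Qed.

(** * States with a flag system *)

(** [t] prepares [phi] beside [A]; an effect on [C] then only contributes its probability on
    [phi]. *)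
Lemma attach_state (A : sys T) {C : sys T} (phi : Tr T sI C) :
  normalized phi -> exists t : Tr T A (cmp A C),
    test [t] /\ forall c : Tr T C sI, slice A c ∘ t = prob c phi • idt A.
Proof.
  intros Hphi; destruct (ax_runit_rev T HT A) as [_ [W [HW [_ E]]]].
  exists ((idt A ⊗ phi) ∘ W); split.
  - apply test_seq1; [apply channel_test, HW|].
    apply test_par1; [apply (ax_test_id T HT)|apply normalized_test, Hphi].
  - intros c; unfold slice; rewrite seq_assoc, <- (seq_assoc _ (idt A ⊗ c)), par_seq.
    rewrite seq_idl, (ax_tval_repr T HT (c ∘ phi)), (ax_par_scalr T HT), (ax_par_id T HT).
    rewrite seq_scalr, seq_idr, seq_scall, E; reflexivity.
Qed.

Lemma prob_eff_scal {A : sys T} r (x : Tr T sI A) : prob (eff A) (r • x) = r * prob (eff A) x.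
Proof. unfold prob; rewrite seq_scalr; apply tval_scal. Qed.

(* A flag system [C] records whether [sigma] or its complement in [rho] was prepared. *)
Lemma flagged_refinement {A : sys T} (sigma rho : Tr T sI A) :
  refines sigma rho -> prob (eff A) rho <> 0 ->
  exists (C : sys T) (omega : Tr T sI (cmp A C)) (c : Tr T C sI),
    normalized omega /\ slice A (eff C) ∘ omega = / prob (eff A) rho • rho /\
    slice A c ∘ omega = / prob (eff A) rho • sigma.
Proof.
  intros Hs Hp; apply refinesE in Hs; destruct Hs as (tau & kap & Ht & Er).
  destruct (ax_perf_dist T HT)
    as (C & phi0 & phi1 & a0 & a1 & H0 & H1 & _ & E0 & _ & E01 & _).
  destruct (attach_state A phi0 H0) as [t0 [Ht0 S0]].
  destruct (attach_state A phi1 H1) as [t1 [Ht1 S1]].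
  (* The flag is [phi0] beside [sigma] and [phi1] beside the complement [tau]. *)
  set (w := t0 ∘ sigma ⊕ t1 ∘ tau).
  assert (Hw : phys w).
  (* The outcome [kap] completes the test; it is followed by [t1] so that the conditioning covers
     every outcome. *)
  { pose proof (ax_test_cond T HT _ _ _ [sigma; tau; kap]
      (fun i => match i with O => [t0] | _ => [t1] end) Ht) as H.
    cbn in H; apply (phys_in [w; t1 ∘ kap]); [|left; reflexivity].
    apply test_merge_l, H; intros [|i] _; assumption. }
  assert (Ec : forall c, slice A c ∘ w = prob c phi0 • sigma ⊕ prob c phi1 • tau).
  { intros c; unfold w; rewrite seq_addr, !seq_assoc, S0, S1, !seq_scall, !seq_idl.
    reflexivity. }
  assert (Ee : slice A (eff C) ∘ w = rho).
  { rewrite Ec, (proj2 H0), (proj2 H1), !scal_1; symmetry; exact Er. }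
  assert (Ew : prob (eff _) w = prob (eff A) rho).
  { unfold prob; rewrite (ax_eff_cmp T HT), product_effect_slice, <- seq_assoc, Ee.
    reflexivity. }
  (* [a0] fires with certainty on [phi0] and never on [phi1], so it selects [sigma]. *)
  exists C, (/ prob (eff A) rho • w), a0; split; [split|split].
  - rewrite <- Ew; apply phys_normalize; [|rewrite Ew]; assumption.
  - rewrite prob_eff_scal, Ew; field; assumption.
  - rewrite seq_scalr, Ee; reflexivity.
  - rewrite seq_scalr, Ec, E0, E01, scal_1, scal_0l, add_0r; reflexivity.
Qed.

(** * Non-disturbance implies no information *)

(** The second equation, with the same [lam], determines [lam] from [rho] alone. *)
Lemma nondisturbing_proportional (HP : Purification T) {A : sys T}
  (sigma rho : Tr T sI A) (l : list (Tr T A A)) i :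
  test l -> (forall s, refines s rho -> tsum l ∘ s = s) ->
  refines sigma rho -> prob (eff A) rho <> 0 -> (i < length l)%nat ->
  exists lam, tnth l i ∘ sigma = lam • sigma /\ tnth l i ∘ rho = lam • rho.
Proof.
  intros Hl Hnd Hs Hp Hi.
  assert (Hr : phys rho) by (eapply refines_phys_r, Hs).
  destruct (flagged_refinement sigma rho Hs Hp) as (C & om & c & Hom & Ee & Ec).
  destruct (proj1 HP _ om Hom) as (D & Phi & [HPhi Hat] & HPn & Em).
  rewrite marginal_slice in Em.
  set (p := prob (eff A) rho) in *.
  assert (Hip : / p <> 0) by (apply Rinv_neq_0_compat; assumption).
  assert (HS : test [tsum l])
    by (apply test_tsum; [assumption|intros ->; cbn in Hi; lia]).
  (* Slicing off [D] and then [C] gives, up to the factor [p], a refinement of [rho], to which the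
     hypothesis applies. *)
  assert (Hsl : forall b d, phys b -> phys d ->
    tsum l ∘ (slice A b ∘ (slice (cmp A C) d ∘ Phi)) = slice A b ∘ (slice (cmp A C) d ∘ Phi)).
  { intros b d Hb Hd; apply (scal_inj p); [assumption|]; rewrite <- seq_scalr.
    apply Hnd.
    assert (HR : refines (slice A b ∘ (slice (cmp A C) d ∘ Phi)) (/ p • rho)).
    { rewrite <- Ee, <- Em.
      do 2 (apply refines_slice; [assumption|]); apply refines_test1, normalized_test, HPn. }
    (* Precomposing with the scalar [eff A ∘ rho], of value [p], turns a refinement of [/ p • rho]
       into one of [rho]. *)
    apply (refines_seq_r (eff A ∘ rho)) in HR;
      [|apply phys_seq; [apply phys_eff|assumption]].
    rewrite !seq_scalar in HR; fold (prob (eff A) rho) p in HR.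
    rewrite scal_mul, Rinv_r, scal_1 in HR by assumption; exact HR. }
  (* Local discriminability is applied twice, first across [D] and then across [C]. *)
  assert (Hfix : (tsum l ⊗ idt C ⊗ idt D) ∘ Phi = Phi).
  { apply fixed_of_slices; [|assumption|].
    - apply phys_par; [apply phys_test1, HS|apply phys_id].
    - intros d Hd; apply fixed_of_slices; [apply phys_test1, HS| |auto].
      apply phys_seq; [apply phys_slice|]; assumption. }
  destruct (test_tnth_compl l i Hl Hi) as [g [Hg Eg]].
  (* [Phi] equals its image under the summed test, so its image under outcome [i] refines it, and
     atomicity gives [lam]. *)
  destruct (Hat (tnth l i ⊗ idt C ⊗ idt D ∘ Phi)) as (lam & _ & El).
  { rewrite <- Hfix at 2; rewrite <- Eg, !(ax_par_addl T HT).
    apply refines_seq_l; [|apply refines_test1, normalized_test, HPn].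
    pose proof (ax_test_par T HT _ _ _ _ _ _ Hg (ax_test_id T HT C)) as H.
    exact (ax_test_par T HT _ _ _ _ _ _ H (ax_test_id T HT D)). }
  (* [tnth l i] is moved past both slices onto [Phi], where it acts as the factor [lam]. *)
  assert (Elam : forall b, tnth l i ∘ (slice A b ∘ om) = lam • (slice A b ∘ om)).
  { intros b; rewrite <- Em, <- !seq_scalr, <- El, !seq_assoc.
    rewrite (slice_nat (tnth l i)), <- (seq_assoc _ (tnth l i ⊗ idt C)), slice_nat, !seq_assoc.
    reflexivity. }
  (* The slice by [c] is [/ p • sigma], and the slice by [eff C] is [/ p • rho]. *)
  exists lam; split; apply (scal_inj (/ p)); try assumption;
    rewrite <- seq_scalr, scal_mul, Rmult_comm, <- scal_mul; rewrite <- ?Ec, <- ?Ee; apply Elam.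
Qed.

(** The pieces of [rho] have nonnegative probabilities that sum to zero. This settles the degenerate
    case excluded above. *)
Lemma refines_eq_0 {A : sys T} (sigma rho : Tr T sI A) :
  refines sigma rho -> prob (eff A) rho = 0 -> sigma = tzero.
Proof.
  intros Hs E; apply state_eq_0; [eapply refines_phys_l, Hs|].
  apply refinesE in Hs; destruct Hs as (tau & kap & Ht & ->).
  unfold prob in *; rewrite seq_addr, tval_add in E.
  assert (0 <= tval (eff A ∘ sigma)).
  { apply (prob_nonneg (eff A)); [apply phys_eff|]; apply (phys_in _ _ Ht); cbn; auto. }
  assert (0 <= tval (eff A ∘ tau)).
  { apply (prob_nonneg (eff A)); [apply phys_eff|]; apply (phys_in _ _ Ht); cbn; auto. }
  lra.
Qed.

Lemma nondisturbing_no_information (HP : Purification T) {A : sys T}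
  (rho : Tr T sI A) (l : list (Tr T A A)) :
  phys rho -> test l -> (forall s, refines s rho -> tsum l ∘ s = s) ->
  exists p : nat -> R, (forall i, (i < length l)%nat -> 0 <= p i) /\
    forall s, refines s rho ->
      forall i, (i < length l)%nat -> tnth l i ∘ s = p i • s.
Proof.
  intros Hr Hl Hnd.
  exists (fun i => prob (eff A) (tnth l i ∘ rho) / prob (eff A) rho); split.
  - intros i Hi; apply Rmult_le_pos.
    + apply prob_nonneg; [apply phys_eff|]; apply phys_seq; [apply phys_tnth|]; assumption.
    + assert (H : 0 <= prob (eff A) rho) by (apply prob_nonneg; [apply phys_eff|assumption]).
      destruct H as [H|<-]; [left; apply Rinv_0_lt_compat, H|rewrite Rinv_0; lra].
  - intros s Hs i Hi; destruct (Req_dec (prob (eff A) rho) 0) as [E|E].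
    + rewrite (refines_eq_0 s rho Hs E), seq_0r, scal_0r; reflexivity.
    + destruct (nondisturbing_proportional HP s rho l i) as (lam & E1 & E2); try assumption.
      rewrite E1, E2, prob_eff_scal; f_equal; field; assumption.
Qed.

(** * No information implies non-disturbance *)

Lemma tsum_proportional {A : sys T} (s : Tr T sI A) (l : list (Tr T A A)) p :
  (forall i, (i < length l)%nat -> tnth l i ∘ s = p i • s) -> exists r, tsum l ∘ s = r • s.
Proof.
  revert p; induction l as [|a l IH]; intros p H.
  - exists 0; cbn; rewrite seq_0l, scal_0l; reflexivity.
  - destruct (IH (fun i => p (S i))) as [r Er].
    { intros i Hi; apply (H (S i)); cbn; lia. }
    exists (p 0%nat + r); cbn; fold (tsum l); rewrite seq_addl, Er, (ax_scal_addr T HT).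
    f_equal; apply (H 0%nat); cbn; lia.
Qed.

(** A test containing [x], followed by the empty one and by [eff B], would be an empty test of
    probabilities, with sum 0 instead of 1. *)
Lemma no_empty_test {A B : sys T} (x : Tr T sI A) : phys x -> ~ test ([] : list (Tr T A B)).
Proof.
  intros [l [Hl _]] H0.
  pose proof (ax_test_seq T HT _ _ _ _ _ (ax_test_seq T HT _ _ _ _ _ Hl H0)
    (ax_eff_test T HT B)) as H.
  apply (ax_prob_sum T HT) in H; cbn in H; lra.
Qed.

(** The summed test is a channel, so it preserves the probability of [eff A]; its factor [r] on a
    nonzero state must then be 1. *)
Lemma no_information_nondisturbing {A : sys T} (s : Tr T sI A) (l : list (Tr T A A)) p :
  phys s -> test l ->
  (forall i, (i < length l)%nat -> tnth l i ∘ s = p i • s) -> tsum l ∘ s = s.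
Proof.
  intros Hs Hl H; destruct (tsum_proportional s l p H) as [r Er].
  assert (HS : test [tsum l]).
  { apply test_tsum; [assumption|]; intros ->; exact (no_empty_test s Hs Hl). }
  assert (E : prob (eff A) s = r * prob (eff A) s).
  { rewrite <- prob_eff_scal, <- Er; unfold prob; rewrite seq_assoc.
    rewrite (ax_eff_unique T HT _ (eff A ∘ tsum l)); [reflexivity|].
    apply test_seq1; [assumption|apply (ax_eff_test T HT)]. }
  destruct (Req_dec (prob (eff A) s) 0) as [E0|E0].
  - rewrite (state_eq_0 s Hs E0), seq_0r; reflexivity.
  - assert (r = 1) as -> by (apply (Rmult_eq_reg_r (prob (eff A) s)); lra).
    rewrite Er; apply scal_1.
Qed.

(** * Internal states and the equivalences *)

Lemma internal_eq_scal {A : sys T} (rho : Tr T sI A) (f : Tr T A A) r :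
  internal rho -> (forall s, refines s rho -> f ∘ s = r • s) ->
  forall x : Tr T sI A, f ∘ x = r • x.
Proof.
  intros [_ Hspan] H x; destruct (Hspan x) as [cs [Hcs ->]].
  induction Hcs as [|c cs Hc _ IH]; cbn.
  - rewrite seq_0r, scal_0r; reflexivity.
  - fold (lincomb cs); rewrite seq_addr, scal_addv, IH, seq_scalr, H by assumption.
    rewrite !scal_mul, Rmult_comm; reflexivity.
Qed.

End Theory.

Theorem mainTheorem5 (T : OPTdata) (HT : OPTAxioms T) (HP : Purification T)
  (A : sys T) (rho : Tr T sI A) (l : list (Tr T A A)) :
  phys rho -> test l ->
  ((forall sigma, refines sigma rho ->
      tsum (map (fun a => seqc a sigma) l) = sigma) <->
   (exists p : nat -> R,
      (forall i, (i < length l)%nat -> (0 <= p i)%R) /\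
      forall sigma, refines sigma rho ->
        forall i, (i < length l)%nat -> seqc (tnth l i) sigma = tscal (p i) sigma))
  /\
  (internal rho ->
   ((forall sigma : Tr T sI A, phys sigma ->
       tsum (map (fun a => seqc a sigma) l) = sigma) <->
    (exists p : nat -> R,
       (forall i, (i < length l)%nat -> (0 <= p i)%R) /\
       forall sigma : Tr T sI A, phys sigma ->
         forall i, (i < length l)%nat -> seqc (tnth l i) sigma = tscal (p i) sigma))).
Proof.
  intros Hr Hl.
  assert (Hfwd : (forall s, refines s rho -> tsum (map (fun a => a ∘ s) l) = s) ->
    exists p : nat -> R, (forall i, (i < length l)%nat -> (0 <= p i)%R) /\
      forall s, refines s rho ->
        forall i, (i < length l)%nat -> tnth l i ∘ s = p i • s).
  { intros H; apply (nondisturbing_no_information HT HP rho l Hr Hl).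
    intros s Hs; rewrite <- (tsum_map_seq HT); auto. }
  (* Stated for a single state, so that it serves refinements of [rho] and arbitrary states
     alike. *)
  assert (Hbwd : forall (p : nat -> R) (s : Tr T sI A), phys s ->
    (forall i, (i < length l)%nat -> tnth l i ∘ s = p i • s) ->
    tsum (map (fun a => a ∘ s) l) = s).
  { intros p s Hs H; rewrite (tsum_map_seq HT).
    exact (no_information_nondisturbing HT s l p Hs Hl H). }
  split; [|intros Hint]; split.
  - exact Hfwd.
  - intros [p [_ H]] s Hs; apply (Hbwd p); auto; eapply refines_phys_l; eassumption.
  (* Refinements of [rho] are states, so the forward direction yields [p]; internality extends the
     equations to all states by linearity. *)
  - intros H; destruct Hfwd as [p [Hp Hsp]].
    { intros s Hs; apply H; eapply refines_phys_l; eassumption. }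
    exists p; split; [assumption|]; intros s _ i Hi.
    apply (internal_eq_scal HT rho); auto.
  - intros [p [_ H]] s Hs; apply (Hbwd p); auto.
Qed.
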